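(* Let $I$ be a set and let $Q$ be a non-empty subset of $l_\infty(I)$, endowed with the metric induced by the norm of $l_\infty(I)$. Then $Q$ is injective if and only if there exist, for each $i \in I$, $1$-Lipschitz maps $\underline{r}_i, \overline{r}_i \colon l_\infty(I \setminus \{i\}) \to \mathbb{R}$ with $\underline{r}_i(y) \le \overline{r}_i(y)$ for all $y \in l_\infty(I \setminus \{i\})$, and subsets $L, U \subset I$ (recording which lower, respectively upper, inequalities are retained; the remaining inequalities are dropped) such that $$Q = \{ x \in l_\infty(I) : \underline{r}_i(\widehat{\pi}_i(x)) \le x_i \text{ for all } i \in L, \text{ and } x_i \le \overline{r}_i(\widehat{\pi}_i(x)) \text{ for all } i \in U \}.$$
   Context: For a set $J$, $l_\infty(J)$ is the space of all bounded functions $f \colon J \to \mathbb{R}$, $f = (f_j)_{j \in J}$, endowed with the norm $\|f\| := \sup_{j \in J} |f_j|$ and the associated metric. For $i \in I$, the map $\widehat{\pi}_i \colon l_\infty(I) \to l_\infty(I \setminus \{i\})$ is given by dropping the $i$-th coordinate (i.e. restriction of functions to $I \setminus \{i\}$). A metric space $(X,d)$ is called injective if for every isometric embedding $\iota \colon A \to B$ of metric spaces and every $1$-Lipschitz map $f \colon A \to X$, there exists a $1$-Lipschitz map $\overline{f} \colon B \to X$ such that $f = \overline{f} \circ \iota$. The index sets $L, U$ may be any subsets of $I$ (including $\emptyset$ and $I$), and they express that an arbitrary subcollection of the full collection of inequalities $\underline{r}_i(\widehat{\pi}_i(x)) \le x_i$ and $x_i \le \overline{r}_i(\widehat{\pi}_i(x))$,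 $i \in I$, may be dropped. *)

(* Defs.v *)
From HB Require Import structures.
From mathcomp Require Import all_boot all_order all_algebra.
From mathcomp Require Import all_classical all_reals all_analysis.

Set Implicit Arguments.
Unset Strict Implicit.
Unset Printing Implicit Defensive.

Import Order.TTheory GRing.Theory Num.Theory.
Import numFieldNormedType.Exports.
Local Open Scope classical_set_scope.
Local Open Scope ring_scope.

Section metric_notions.
Context {R : realType}.

Definition lipschitz1 (X Y : metricType R) (f : X -> Y) : Prop :=
  forall x y, mdist (f x) (f y) <= mdist x y.

Definition isometric (X Y : metricType R) (f : X -> Y) : Prop :=
  forall x y, mdist (f x) (f y) = mdist x y.

(* [A] and [B] range over all metric spaces, the empty ones included. *)
Definition injective_space (X : metricType R) : Prop :=
  forall (A B : metricType R) (iota : A -> B) (f : A -> X),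
    isometric iota -> lipschitz1 f ->
    exists2 fbar : B -> X, lipschitz1 fbar & f = fbar \o iota.

End metric_notions.

(* The metric induced on a subset; it extends the pseudometric structure that
   the library already puts on [set_type A]. *)
Section induced_metric.
Context {R : realType} {X : metricType R} (A : set X).

Let idist (x y : A) : R := mdist (set_val x) (set_val y).

Let idist_ge0 x y : 0 <= idist x y.
Proof. exact: mdist_ge0. Qed.

Let idist_positivity x y : idist x y = 0 -> x = y.
Proof. by move=> /mdist_positivity/val_inj. Qed.

Let ball_idist (x : A) d : ball x d = [set y | idist x y < d].
Proof.
by apply/seteqP; split=> y; rewrite {1}/ball /= /initial_ball ballEmdist.
Qed.

HB.instance Definition _ := @PseudoMetric_isMetric.Build R (set_type A)
  idist idist_ge0 idist_positivity ball_idist.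

End induced_metric.

Record linf (R : realType) (J : Type) : Type := Linf {
  linf_fun :> J -> R ;
  linf_bounded : bounded_fun linf_fun }.

(* [sup] is the supremum in [R]; it is [0] on the empty set, so that
   [linf R J] is a single point when [J] is empty. *)
Definition linf_norm (R : realType) (J : Type) (f : J -> R) : R :=
  sup [set `|f j| | j in [set: J]].

Section linf_metric.
Context {R : realType} {J : Type}.
Implicit Types f g h : linf R J.

Lemma linf_ext f g : f =1 g -> f = g.
Proof.
case: f g => [f bf] [g bg] /= /funext fg; case: _ / fg bg => bg.
by congr Linf; exact: Prop_irrelevance.
Qed.

HB.instance Definition _ := gen_eqMixin (linf R J).
HB.instance Definition _ := gen_choiceMixin (linf R J).

Let dist f g : R := linf_norm (f \- g).

Lemma linf_bound f : exists M, forall j, `|f j| <= M.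
Proof.
have /pinfty_ex_gt0[M _ fM] := linf_bounded f.
by exists M => j; exact: fM.
Qed.

Lemma linf_norm_ub f g j : `|f j - g j| <= linf_norm (f \- g).
Proof.
apply: ub_le_sup; last by exists j.
have [M fM] := linf_bound f; have [N gN] := linf_bound g.
exists (M + N) => _ [k _ <-] /=; apply: (le_trans (ler_normB _ _)).
by rewrite lerD ?fM ?gN.
Qed.

Lemma linf_norm_le (f : J -> R) (c : R) : 0 <= c ->
  (forall j, `|f j| <= c) -> linf_norm f <= c.
Proof.
move=> c0 fc; rewrite /linf_norm.
have [->|/set0P S0] := eqVneq [set `|f j| | j in [set: J]] set0.
  by rewrite sup0.
by apply: ge_sup => // _ [j _ <-].
Qed.

Lemma linf_norm_ge0 (f : J -> R) : 0 <= linf_norm f.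
Proof.
have [supS|noS] := pselect (has_sup [set `|f j| | j in [set: J]]); last first.
  by rewrite /linf_norm sup_out.
have [_ [j _ _]] := supS.1; apply: (le_trans (normr_ge0 (f j))).
by apply: ub_le_sup; [exact: supS.2|exists j].
Qed.

Let distxx f : dist f f = 0.
Proof.
apply/eqP; rewrite eq_le linf_norm_ge0 andbT; apply: linf_norm_le => // j.
by rewrite /= subrr normr0.
Qed.

Let dist_positivity f g : dist f g = 0 -> f = g.
Proof.
move=> fg0; apply: linf_ext => j; apply/eqP; rewrite -subr_eq0 -normr_le0.
by rewrite -fg0; exact: linf_norm_ub.
Qed.

Let dist_sym f g : dist f g = dist g f.
Proof. by congr sup; apply: eq_imagel => j _ /=; rewrite distrC. Qed.

Let dist_triangle g f h : dist f h <= dist f g + dist g h.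
Proof.
apply: linf_norm_le => [|j /=]; first by rewrite addr_ge0 ?linf_norm_ge0.
by rewrite (le_trans (ler_distD (g j) _ _))// lerD// linf_norm_ub.
Qed.

HB.instance Definition _ := @isMetric.Build R (linf R J)
  dist distxx dist_positivity dist_sym dist_triangle.

Lemma linf_mdistE f g : mdist f g = linf_norm (f \- g).
Proof. by []. Qed.

End linf_metric.

(* The map dropping the [i]-th coordinate; [[set~ i]] is the set of the
   indices different from [i], seen as a type. *)
Section drop_coordinate.
Context {R : realType} {I : Type} (i : I).

Lemma drop_coord_bounded (x : linf R I) :
  bounded_fun (fun j : [set~ i] => x (set_val j)).
Proof.
have := linf_bounded x; rewrite /= /bounded_near.
by apply: filterS => M xM j _; exact: xM.
Qed.

Definition drop_coord (x : linf R I) : linf R [set~ i] :=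
  Linf (@drop_coord_bounded x).

End drop_coordinate.

(* Main.v *)
Require Import Defs.
From mathcomp Require Import all_boot all_order all_algebra.
From mathcomp Require Import all_classical all_reals all_analysis.
From mathcomp Require Import lra.

Set Implicit Arguments.
Unset Strict Implicit.
Unset Printing Implicit Defensive.

Import Order.TTheory GRing.Theory Num.Theory.
Import numFieldNormedType.Exports.
Local Open Scope classical_set_scope.
Local Open Scope ring_scope.

(** Both sides of the equivalence say that [Q] is the fixed point set of a
    1-Lipschitz map [G] from [linf R I] to itself.

    If [Q] is injective, the identity of [Q] extends to a 1-Lipschitz
    retraction [rho] of [linf R I] onto [Q], and [x] lies in [Q] if and only if
    [rho x i <= x i] and [x i <= rho x i] for all [i].  Along a line parallel
    to the [i]-th axis, [t] minus the [i]-th coordinate of [rho] is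
    nondecreasing in [t], so each of these two inequalities compares [x i] with
    a threshold depending on the other coordinates only; as moving the other
    coordinates by [d] and [t] by [d] moves the point by [d], the threshold is
    1-Lipschitz ([threshold]).  It is infinite exactly when the inequality
    always holds, and then it is dropped.  The lower threshold is at most the
    upper one, since on each line every [t] satisfies one of the two
    inequalities ([coordinate_thresholds]).

    Conversely, if [Q] is given by inequalities, clamping each coordinate of
    [x] between its bounds defines a 1-Lipschitz map whose fixed point set is
    [Q] ([inequalities_fixed_points]).  The space [linf R I] is hyperconvex:
    any family of closed balls with pairwise [d c c' <= r + r'] has a common
    point ([linf_hyperconvex]).  By a theorem of Baillon the fixed point set
    of a 1-Lipschitz map on a hyperconvex space is empty or hyperconvex
    ([fixed_points_hyperconvex]), and hyperconvex spaces are injective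
    ([hyperconvex_injective], after Aronszajn and Panitchpakdi). *)

(** * Maximal sets *)

(** Maximality in the form used below: whatever can be added to a maximal set
    is already in it. *)
Lemma Zorn_absorb (T : Type) (P : set (set T)) :
  (forall F : set (set T), F `<=` P -> total_on F subset ->
    P (\bigcup_(A in F) A)) ->
  exists M, P M /\ forall B, P (M `|` B) -> B `<=` M.
Proof.
move=> chainP; have [M [PM maxM]] := Zorn_bigcup chainP.
exists M; split=> // B PB; apply: contrapT => nBM.
apply: (maxM (M `|` B)) => //; split; first exact: subsetUl.
by move=> MBM; apply: nBM; apply: subset_trans MBM; exact: subsetUr.
Qed.

(** A pairwise condition passes to the union of a chain, because two members
    of the union already lie in one member of the chain. *)
Lemma chain_pair (T : Type) (A : set T) (F : set (set T)) (p q : T) :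
  total_on F subset ->
  (A `|` \bigcup_(B in F) B) p -> (A `|` \bigcup_(B in F) B) q ->
  (A p /\ A q) \/ exists2 B, F B & (A `|` B) p /\ (A `|` B) q.
Proof.
move=> totF [Ap|[B FB Bp]] [Aq|[C FC Cq]].
- by left.
- by right; exists C => //; split; [left|right].
- by right; exists B => //; split; [right|left].
- right; have [BC|CB] := totF B C FB FC.
    by exists C => //; split; right => //; exact: BC.
  by exists B => //; split; right => //; exact: CB.
Qed.

(** * Hyperconvex spaces *)

Section hyperconvexity.
Context {R : realType}.

(** A family of closed balls is encoded as a set of pairs (center, radius). *)
Definition inter_balls (X : metricType R) (H : set (X * R)) : set X :=
  [set z | forall p, H p -> mdist z p.1 <= p.2].

Definition compatible_balls (X : metricType R) (H : set (X * R)) : Prop :=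
  forall p q, H p -> H q -> mdist p.1 q.1 <= p.2 + q.2.

Definition hyperconvex (X : metricType R) : Prop :=
  forall H : set (X * R), compatible_balls H -> inter_balls H !=set0.

Lemma compatible_inter_balls (X : metricType R) (H : set (X * R)) :
  inter_balls H !=set0 -> compatible_balls H.
Proof.
move=> [z Hz] p q Hp Hq; apply: (le_trans (metric_triangle _ z _)).
by rewrite lerD ?Hz// metric_sym Hz.
Qed.

(** A set of pairs satisfying [nonexpansive] is the graph of a 1-Lipschitz map
    on a part of [B]: pairs with the same first component coincide.  In a
    maximal graph every point [b] is reached, for the balls around the values
    [p.2] with radii [mdist b p.1] are compatible and a common point of them is
    an admissible value at [b]. *)
Lemma hyperconvex_injective (X : metricType R) :
  hyperconvex X -> injective_space X.
Proof.
move=> hX A B iota f iotaI fL.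
pose nonexpansive (g : set (B * X)) :=
  forall p q, g p -> g q -> mdist p.2 q.2 <= mdist p.1 q.1.
pose g0 : set (B * X) := range (fun a => (iota a, f a)).
have g0N : nonexpansive g0.
  by move=> _ _ [a _ <-] [b _ <-] /=; rewrite iotaI; exact: fL.
have [|g [gN gmax]] := @Zorn_absorb _ [set g | nonexpansive (g0 `|` g)].
  move=> F FN totF p q pF qF.
  have [[p0 q0]|[g Fg [gp gq]]] := chain_pair totF pF qF; first exact: g0N.
  exact: (FN _ Fg).
have total_g b : exists x, (g0 `|` g) (b, x).
  have [|x Hx] := hX [set (p.2, mdist b p.1) | p in g0 `|` g].
    move=> _ _ [p gp <-] [q gq <-] /=; apply: (le_trans (gN _ _ gp gq)).
    by rewrite (metric_sym b); exact: metric_triangle.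
  have bx p : (g0 `|` g) p -> mdist x p.2 <= mdist b p.1.
    by move=> gp; apply: (Hx (p.2, mdist b p.1)); exists p.
  exists x; right; apply: (gmax [set (b, x)]) => //= p q.
  rewrite setUA => -[gp|->] [gq|->] /=.
  - exact: gN.
  - by rewrite metric_sym (metric_sym _ b); exact: bx.
  - exact: bx.
  - by rewrite !mdistxx.
have [fbar fbarP] := choice total_g.
exists fbar; first by move=> b c; exact: (gN _ _ (fbarP b) (fbarP c)).
apply/funext => a /=; apply: mdist_positivity; apply/eqP.
rewrite eq_le mdist_ge0 andbT -(mdistxx (iota a)).
by apply: (gN (_, _) (_, _) _ (fbarP _)); left; exists a.
Qed.

(** Baillon's theorem, with the minimality argument of Penot and Kirk.  As the
    centers are fixed, [G] maps the intersection of the given balls into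
    itself.  Among the nonempty [G]-invariant intersections of balls contained
    in it, take a minimal one, [D].  By minimality every ball containing the
    image of [D] contains [D].  Hence the points of [D] at distance at most
    half the diameter from all of [D], which exist by hyperconvexity, form
    another invariant intersection of balls, so they are all of [D] and the
    diameter is 0. *)
Lemma fixed_points_hyperconvex (X : metricType R) (G : X -> X)
    (H0 : set (X * R)) :
  hyperconvex X -> lipschitz1 G -> (exists x, G x = x) ->
  (forall p, H0 p -> G p.1 = p.1) -> compatible_balls H0 ->
  exists2 z, G z = z & inter_balls H0 z.
Proof.
move=> hX GL [x Gx] GH0 cH0.
have [H00|/set0P[p0 H0p0]] := eqVneq H0 set0.
  by exists x => // p; rewrite H00.
pose invariant (H : set (X * R)) :=
  forall z, inter_balls H z -> inter_balls H (G z).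
have invH0 : invariant H0.
  by move=> z H0z p H0p; rewrite -(GH0 p)//; apply: (le_trans (GL _ _)) (H0z _ _).
have [|H [[[z0 Dz0] invD] maxH]] := @Zorn_absorb _
    [set H | inter_balls (H0 `|` H) !=set0 /\ invariant (H0 `|` H)].
  move=> F FP totF; split.
    apply: hX => p q pF qF.
    have [[p0' q0']|[H FH [Hp Hq]]] := chain_pair totF pF qF; first exact: cH0.
    by apply: (compatible_inter_balls (FP _ FH).1).
  move=> z Dz p [H0p|[H FH Hp]].
    by apply: invH0 => // q H0q; apply: Dz; left.
  apply: ((FP _ FH).2 z) => [q [H0q|Hq]|]; last by right.
    by apply: Dz; left.
  by apply: Dz; right; exists H.
set D := inter_balls (H0 `|` H) in Dz0 invD.
(* Otherwise this ball could be added to [H]. *)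
have sub_ball c r : (forall z, D z -> mdist (G z) c <= r) ->
    forall z, D z -> mdist z c <= r.
  move=> GDcr z Dz; suff Hcr : H (c, r) by apply: (Dz (c, r)); right.
  apply: (maxH [set (c, r)]) => //; split.
    exists (G z0) => p; rewrite setUA => -[Hp|->]; last exact: GDcr.
    by apply: invD Hp.
  move=> w Dw; have {}Dw : D w by move=> p Hp; apply: Dw; rewrite setUA; left.
  by move=> p; rewrite setUA => -[Hp|->]; [exact: invD|exact: GDcr].
pose distances := [set mdist y.1 y.2 | y in D `*` D].
pose diam := sup distances.
have le_diam y z : D y -> D z -> mdist y z <= diam.
  move=> Dy Dz; apply: ub_le_sup; last by exists (y, z).
  exists (p0.2 + p0.2) => _ [u [Du1 Du2] <-].
  apply: (le_trans (metric_triangle _ p0.1 _)).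
  by rewrite (metric_sym p0.1) lerD//; [apply: Du1|apply: Du2]; left.
have diam_ge0 : 0 <= diam by rewrite -(mdistxx z0) le_diam.
have half_diam y z : D y -> D z -> mdist z y <= diam / 2.
  move=> Dy Dz; suff Hy : H (y, diam / 2) by apply: (Dz (_, _)); right.
  apply: (maxH [set (y, diam / 2) | y in D]); last by exists y.
  split.
    apply: hX => p q; rewrite setUA => -[Hp|[v Dv <-]] [Hq|[w Dw <-]] /=.
    - by apply: (@compatible_inter_balls _ (H0 `|` H)) => //; exists z0.
    - rewrite metric_sym; apply: (le_trans (Dw p Hp)).
      by rewrite lerDl divr_ge0.
    - by apply: (le_trans (Dv q Hq)); rewrite lerDr divr_ge0.
    - by rewrite -splitr le_diam.
  move=> w Cw; have Dw : D w by move=> p Hp; apply: Cw; rewrite setUA; left.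
  move=> p; rewrite setUA => -[Hp|[v Dv <-]] /=; first exact: invD.
  rewrite metric_sym; apply: sub_ball Dv => u Du.
  apply: (le_trans (GL _ _)); rewrite metric_sym.
  by apply: (Cw (u, diam / 2)); do 2 right; exists u.
have diam0 : diam <= 0.
  have : diam <= diam / 2.
    apply: ge_sup; first by exists (mdist z0 z0), (z0, z0).
    by move=> _ [u [Du1 Du2] <-]; exact: half_diam.
  lra.
exists z0; last by move=> p H0p; apply: Dz0; left.
apply: mdist_positivity; apply/eqP; rewrite eq_le mdist_ge0 andbT.
by apply: le_trans diam0; apply: le_diam => //; exact: invD.
Qed.

End hyperconvexity.

(** * Coordinates in the space of bounded functions *)

Section linf_coordinates.
Context {R : realType}.

Lemma lipschitz1_real (X : metricType R) (f : X -> R^o) :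
  lipschitz1 f <-> forall x y, f x - f y <= mdist x y.
Proof.
split=> fL x y.
  by apply: le_trans (fL x y); rewrite metric_sym; exact: ler_norm.
rewrite [leLHS]metric_sym; change (`|f x - f y| <= mdist x y).
by rewrite ler_norml fL andbT lerNl opprB metric_sym fL.
Qed.

Section index.
Context {J : Type}.
Implicit Types x y : linf R J.

Lemma linf_coord_le x y j : x j - y j <= mdist x y.
Proof. exact: le_trans (ler_norm _) (linf_norm_ub _ _ _). Qed.

Lemma linf_dist_le x y c : 0 <= c -> (forall j, `|x j - y j| <= c) ->
  mdist x y <= c.
Proof. by move=> c0 xyc; exact: linf_norm_le. Qed.

Lemma linf_of_bound (f : J -> R) M : (forall j, `|f j| <= M) ->
  exists x : linf R J, forall j, x j = f j.
Proof.
move=> fM; suff bf : bounded_fun (f : J -> R^o) by exists (Linf bf).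
exists M; split; first exact: num_real.
by move=> N MN j _; apply: (le_trans (fM j)); exact: ltW.
Qed.

Lemma linf_of_near x (f : J -> R) c : (forall j, `|f j - x j| <= c) ->
  exists y : linf R J, forall j, y j = f j.
Proof.
move=> fxc; have [M xM] := linf_bound x.
apply: (@linf_of_bound _ (c + M)) => j; rewrite -(subrK (x j) (f j)).
by apply: (le_trans (ler_normD _ _)); exact: lerD.
Qed.

(** In each coordinate the balls become intervals, and the supremum of the
    left endpoints lies in all of them. *)
Lemma linf_hyperconvex : hyperconvex (linf R J).
Proof.
move=> H cH.
have [->|/set0P[p0 Hp0]] := eqVneq H set0.
  have [|z _] := @linf_of_bound (fun=> 0) 0; first by move=> j; rewrite normr0.
  by exists z => p.
pose f j := sup [set p.1 j - p.2 | p in H].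
have f_near p j : H p -> `|f j - p.1 j| <= p.2.
  move=> Hp; have ub : ubound [set q.1 j - q.2 | q in H] (p.1 j + p.2).
    move=> _ [q Hq <-]; have := linf_coord_le q.1 p.1 j.
    have := cH _ _ Hq Hp; lra.
  have le_f : p.1 j - p.2 <= f j by apply: ub_le_sup; [exists (p.1 j + p.2)|exists p].
  have f_le : f j <= p.1 j + p.2 by apply: ge_sup => //; exists (p.1 j - p.2), p.
  by rewrite ler_distl le_f f_le.
have [z zf] := linf_of_near (fun j => f_near p0 j Hp0).
exists z => p Hp; apply: linf_dist_le => [|j]; last by rewrite zf f_near.
have := cH _ _ Hp Hp; rewrite mdistxx; lra.
Qed.

End index.

Lemma linf_dist_drop (I : Type) (i : I) (x y : linf R I) :
  mdist x y <= Num.max `|x i - y i| (mdist (drop_coord i x) (drop_coord i y)).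
Proof.
apply: linf_dist_le => [|j]; first by rewrite le_max normr_ge0.
have [->|ji] := pselect (j = i); first by rewrite le_max lexx.
rewrite le_max; apply/orP; right.
have {}ji : [set~ i] j by [].
exact: (linf_norm_ub (drop_coord i x) (drop_coord i y) (SigSub (mem_set ji))).
Qed.

Lemma drop_coord_le (I : Type) (i : I) (x y : linf R I) :
  mdist (drop_coord i x) (drop_coord i y) <= mdist x y.
Proof.
apply: linf_dist_le => [|j]; first exact: mdist_ge0.
exact: (linf_norm_ub x y (set_val j)).
Qed.

Lemma insert_coord (I : Type) (i : I) (y : linf R [set~ i]) (t : R) :
  exists x : linf R I, drop_coord i x = y /\ x i = t.
Proof.
pose f j := if pselect ([set~ i] j) is left ji then y (SigSub (mem_set ji))
            else t.
have [M yM] := linf_bound y.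
have [|x xf] := @linf_of_bound _ f (Num.max M `|t|).
  by move=> j; rewrite /f; case: pselect => ji; rewrite le_max ?yM ?lexx ?orbT.
exists x; split; last by rewrite xf /f; case: pselect => // nii; case: (nii erefl).
apply: linf_ext => j /=; rewrite xf /f; case: pselect => [ji|].
  by congr (y _); apply: val_inj.
by have := set_valP j.
Qed.

End linf_coordinates.

(** * Inequalities from a retraction *)

Section thresholds.
Context {R : realType}.

(** Read [h] as a coordinate, up to sign, and [pi] as the projection forgetting
    it.  The set [S] of the [z] with [g z <= h z] contains with [z] every [w]
    such that [h w - h z] is at least the distance from [pi w] to [pi z], so it
    is the region above a 1-Lipschitz graph: that of the infimum over [S] of
    the cones with apex [z].  A point outside [S] bounds this infimum below. *)
Lemma threshold (X Y : metricType R) (pi : X -> Y) (h g : X -> R) :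
  (forall z w, mdist z w <= Num.max `|h z - h w| (mdist (pi z) (pi w))) ->
  (forall z w, g z - g w <= mdist z w) ->
  (exists z, g z <= h z) -> (exists w, h w < g w) ->
  exists2 a : Y -> R^o, lipschitz1 a &
    forall w, a (pi w) <= h w <-> g w <= h w.
Proof.
move=> dist_le gL [z0 Sz0] [w0 nSw0].
(* The error doubles because the hypothesis only gives [- e <= h w - h z], so
   that [`|h w - h z|] can exceed [h w - h z] by [2 * e]. *)
have above z w e : 0 <= e -> g z <= h z ->
    mdist (pi w) (pi z) <= h w - h z + e -> g w <= h w + 2 * e.
  move=> e0 Sz wz; have := gL w z; have := dist_le w z.
  have d0 := mdist_ge0 (pi w) (pi z).
  have : Num.max `|h w - h z| (mdist (pi w) (pi z)) <= h w - h z + 2 * e.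
    by rewrite ge_max ler_norml; apply/andP; split; [apply/andP; split|]; lra.
  lra.
pose cones y := [set h z + mdist y (pi z) | z in [set z | g z <= h z]].
pose a y := inf (cones y).
have cones0 y : cones y !=set0 by exists (h z0 + mdist y (pi z0)), z0.
have lb y : has_lbound (cones y).
  exists (h w0 - mdist y (pi w0)) => _ [z Sz <-]; rewrite leNgt; apply/negP => lt.
  have : g w0 <= h w0 + 2 * 0.
    apply: (above z) => //; have := metric_triangle (pi w0) y (pi z).
    rewrite (metric_sym (pi w0) y); lra.
  lra.
exists a.
  apply/lipschitz1_real => y y'; rewrite lerBlDr -lerBlDl.
  apply: lb_le_inf => // _ [z Sz <-].
  have : a y <= h z + mdist y (pi z) by apply: ge_inf => //; exists z.
  have := metric_triangle y y' (pi z); lra.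
move=> w; split=> [aw|Sw]; last first.
  by apply: ge_inf => //; exists w => //; rewrite mdistxx addr0.
apply/ler_addgt0Pr => e e0.
have [|_ [z Sz <-] zw] := @inf_lt _ _ (h w + e / 2) (cones0 (pi w)).
  by apply: (le_lt_trans aw); rewrite ltrDl divr_gt0.
have e20 : 0 <= e / 2 by rewrite divr_ge0// ltW.
by have := above z w (e / 2) e20 Sz; lra.
Qed.

(** If both thresholds are finite and the lower one exceeded the upper one at
    [y], the point over [y] halfway between them would violate both
    inequalities between [w i] and [rho w i]. *)
Lemma coordinate_thresholds (I : Type) (rho : linf R I -> linf R I)
    (x : linf R I) (i : I) :
  lipschitz1 rho -> rho x = x ->
  exists (lo up : linf R [set~ i] -> R^o) (Li Ui : Prop),
    [/\ lipschitz1 lo, lipschitz1 up, forall y, lo y <= up y &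
      forall w, ((Li -> lo (drop_coord i w) <= w i) /\
                 (Ui -> w i <= up (drop_coord i w))) <-> rho w i = w i].
Proof.
move=> rhoL rhox.
have rho_coord z w j : rho z j - rho w j <= mdist z w.
  exact: le_trans (linf_coord_le _ _ _) (rhoL _ _).
have lower : (exists w : linf R I, w i < rho w i) ->
    exists2 lo : linf R [set~ i] -> R^o, lipschitz1 lo &
      forall w, lo (drop_coord i w) <= w i <-> rho w i <= w i.
  apply: (threshold (linf_dist_drop i)) => [z w|]; first exact: rho_coord.
  by exists x; rewrite rhox.
have upper : (exists w : linf R I, rho w i < w i) ->
    exists2 up : linf R [set~ i] -> R^o, lipschitz1 up &
      forall w : linf R I, w i <= up (drop_coord i w) <-> w i <= rho w i.
  move=> [v vP].
  have [||||a aL aP] := @threshold _ _ (drop_coord i)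
      (fun w : linf R I => - w i) (fun w => - rho w i).
  - move=> z w; rewrite -opprD normrN; exact: linf_dist_drop.
  - by move=> z w; rewrite opprK addrC metric_sym; exact: rho_coord.
  - by exists x; rewrite rhox.
  - by exists v; rewrite ltrN2.
  - exists (fun y => - a y).
      apply/lipschitz1_real => y y'; rewrite opprK addrC metric_sym.
      by move/lipschitz1_real : aL; exact.
    by move=> w; rewrite lerNr; rewrite aP lerN2.
have const0 : lipschitz1 ((fun=> 0) : linf R [set~ i] -> R^o).
  by apply/lipschitz1_real => y y'; rewrite subrr mdist_ge0.
have [/lower[a aL aP]|noL] := pselect (exists w : linf R I, w i < rho w i);
  have [/upper[b bL bP]|noU] := pselect (exists w : linf R I, rho w i < w i).
- exists a, b, True, True; split=> // [y|w]; last first.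
    split=> [[/(_ Logic.I)/aP ? /(_ Logic.I)/bP ?]|ww]; first by apply/le_anti/andP.
    by split=> _; [apply/aP|apply/bP]; rewrite ww.
  rewrite leNgt; apply/negP => ba.
  have [w [wy wi]] := insert_coord y ((a y + b y) / 2).
  have := aP w; have := bP w; rewrite wy wi => bw aw.
  have [rw|/ltW rw] := leP (rho w i) ((a y + b y) / 2).
    by move/aw : rw; lra.
  by move/bw : rw; lra.
- exists a, a, True, False; split=> // w; split=> [[/(_ Logic.I)/aP ? _]|ww].
    by apply/le_anti/andP; split=> //; rewrite leNgt; apply/negP => ?; apply: noU; exists w.
  by split=> // _; apply/aP; rewrite ww.
- exists b, b, False, True; split=> // w; split=> [[_ /(_ Logic.I)/bP ?]|ww].
    by apply/le_anti/andP; split=> //; rewrite leNgt; apply/negP => ?; apply: noL; exists w.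
  by split=> // _; apply/bP; rewrite ww.
- exists (fun=> 0), (fun=> 0), False, False; split=> // w; split=> // _.
  by apply/le_anti/andP; split; rewrite leNgt; apply/negP => ?;
    [apply: noL|apply: noU]; exists w.
Qed.

End thresholds.

(** * Inequalities as fixed point equations *)

Section clamping.
Context {R : realType} {I : Type}.
Variables (rlow rup : forall i : I, linf R [set~ i] -> R^o) (L U : set I).
Arguments rlow : clear implicits.
Arguments rup : clear implicits.
Hypothesis rlowL : forall i, lipschitz1 (rlow i).
Hypothesis rupL : forall i, lipschitz1 (rup i).
Hypothesis rlow_up : forall i y, rlow i y <= rup i y.

Definition inequalities : set (linf R I) := [set x |
  (forall i, L i -> rlow i (drop_coord i x) <= x i) /\
  (forall i, U i -> x i <= rup i (drop_coord i x))].

Let cap i (x : linf R I) : R :=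
  if `[< U i >] then Num.min (x i) (rup i (drop_coord i x)) else x i.

Let clamp i (x : linf R I) : R :=
  if `[< L i >] then Num.max (rlow i (drop_coord i x)) (cap i x) else cap i x.

Let bound_le i (r : linf R [set~ i] -> R^o) (x y : linf R I) :
  lipschitz1 r -> r (drop_coord i x) <= r (drop_coord i y) + mdist x y.
Proof.
move/lipschitz1_real/(_ (drop_coord i x) (drop_coord i y)) => rxy.
by rewrite -lerBlDl; exact: le_trans rxy (drop_coord_le _ _ _).
Qed.

Let cap_le i x y : cap i x <= cap i y + mdist x y.
Proof.
have xy : x i <= y i + mdist x y by rewrite -lerBlDl linf_coord_le.
rewrite /cap; case: asboolP => // _.
rewrite -lerBlDr le_min !lerBlDr !ge_min xy /=.
by rewrite (bound_le x y (@rupL i)) orbT.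
Qed.

Let clamp_le i x y : clamp i x <= clamp i y + mdist x y.
Proof.
rewrite /clamp; case: asboolP => // _; rewrite ge_max; apply/andP; split.
  apply: (le_trans (bound_le x y (@rlowL i))).
  by rewrite lerD2r le_max lexx.
by apply: (le_trans (cap_le i x y)); rewrite lerD2r le_max lexx orbT.
Qed.

Let clampP x : inequalities x <-> forall i, clamp i x = x i.
Proof.
split=> [[Lx Ux] i|fx].
  have capx : cap i x = x i.
    by rewrite /cap; case: asboolP => // /Ux; exact: min_l.
  by rewrite /clamp capx; case: asboolP => // /Lx; exact: max_r.
split=> i Hi; have := fx i; have := rlow_up (drop_coord i x); rewrite /clamp.
  by rewrite (asboolT Hi) => _ <-; rewrite le_max lexx.
rewrite /cap (asboolT Hi) => lu; case: asboolP => _ <-.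
  by rewrite ge_max lu ge_min lexx orbT.
by rewrite ge_min lexx orbT.
Qed.

(** The bounds of different coordinates need not be uniformly bounded; a point
    [q] of the set ensures that the clamped family is a bounded function, as
    clamping fixes [q] and so moves [x] to within [mdist x q] of [q]. *)
Lemma inequalities_fixed_points : inequalities !=set0 ->
  exists2 G : linf R I -> linf R I, lipschitz1 G &
    forall x, inequalities x <-> G x = x.
Proof.
move=> [q /clampP qfix].
have clamp_dist x y i : `|clamp i x - clamp i y| <= mdist x y.
  by rewrite ler_distl clamp_le andbT lerBlDr metric_sym clamp_le.
have exG x : exists z : linf R I, forall i, z i = clamp i x.
  by apply: (@linf_of_near _ _ q _ (mdist x q)) => i; rewrite -qfix.
have [G GE] := choice exG; exists G => [x y|x].
  by apply: linf_dist_le => [|i]; [exact: mdist_ge0|rewrite !GE].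
rewrite clampP; split=> [fx|Gx i]; last by rewrite -GE Gx.
by apply: linf_ext => i; rewrite GE.
Qed.

End clamping.

(** * The characterization of injective subsets *)

Theorem theorem1p1 (R : realType) (I : Type) (Q : set (linf R I))
    (Q_neq0 : Q !=set0) :
  injective_space (set_type Q : metricType R) <->
  exists (rlow rup : forall i : I, linf R [set~ i] -> R^o) (L U : set I),
    [/\ forall i, lipschitz1 (rlow i),
        forall i, lipschitz1 (rup i),
        forall i (y : linf R [set~ i]), rlow i y <= rup i y
      & Q = [set x : linf R I |
              (forall i, L i -> rlow i (drop_coord i x) <= x i) /\
              (forall i, U i -> x i <= rup i (drop_coord i x))]].
Proof.
split=> [injQ|[rlow [rup [L [U [rlowL rupL rlow_up QE]]]]]].
  have [//|//|rho rhoL /esym rhoK] :=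
    injQ (set_type Q) (linf R I) set_val id.
  pose r x : linf R I := set_val (rho x).
  have rL : lipschitz1 r by exact: rhoL.
  have rQ x : Q x -> r x = x.
    by move=> Qx; have /= := congr1 (fun f => f (SigSub (mem_set Qx))) rhoK;
       rewrite /r => ->.
  have [q Qq] := Q_neq0.
  have coord i : {lo : linf R [set~ i] -> R^o & {up : linf R [set~ i] -> R^o &
      {Li : Prop & {Ui : Prop |
        [/\ lipschitz1 lo, lipschitz1 up, forall y, lo y <= up y &
          forall w, ((Li -> lo (drop_coord i w) <= w i) /\
                     (Ui -> w i <= up (drop_coord i w))) <-> r w i = w i]}}}}.
    have /cid[lo /cid[up /cid[Li /cid[Ui P]]]] :=
      coordinate_thresholds i rL (rQ q Qq).
    by exists lo, up, Li, Ui.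
  have [lo /all_tag[up /all_tag[L /all_sig[U LUP]]]] := all_tag coord.
  exists lo, up, L, U; split=> [i|i|i|]; [by case: (LUP i)..|].
  apply/seteqP; split=> [x Qx|x /= [Lx Ux]].
    by split=> i; case: (LUP i) => _ _ _ /(_ x); rewrite rQ// => -[_ []].
  have <- : r x = x.
    apply: linf_ext => i; case: (LUP i) => _ _ _ /(_ x)[+ _]; apply.
    by split; [exact: Lx|exact: Ux].
  exact: set_valP.
have [|G GL GE] := inequalities_fixed_points (L := L) (U := U) rlowL rupL rlow_up.
  by rewrite /inequalities -QE.
have {}GE x : Q x <-> G x = x by rewrite -GE QE.
apply: hyperconvex_injective => H cH.
have [|||z /GE Qz Hz] := @fixed_points_hyperconvex _ _ G
    [set (set_val p.1, p.2) | p in H] linf_hyperconvex GL.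
- by case: Q_neq0 => q /GE Gq; exists q.
- by move=> _ [p Hp <-]; apply/GE; exact: set_valP.
- by move=> _ _ [p Hp <-] [p' Hp' <-]; exact: cH.
exists (SigSub (mem_set Qz)) => p Hp.
by apply: (Hz (set_val p.1, p.2)); exists p.
Qed.
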